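(* Let $F$ be a field of characteristic different from $2$ such that every element of $F$ is a square. Let $D(n)$ be the number of $B$-congruence orbits of symmetric $n\times n$ matrices over $F$. Then $D(n)$ satisfies the recursive relation $$D(0)=1;\quad D(1)=2;\quad D(n)=2D(n-1)+(n-1)D(n-2),\ n\ge 2.$$
   Context: $X'$ denotes the transpose of $X$. $B$ is the group of all invertible upper triangular $n\times n$ matrices over $F$. Two $n\times n$ matrices $X,Y$ over $F$ are $B$-congruent if there exists $h\in B$ with $h'Xh=Y$. For $n=0$ there is a single (empty) matrix, giving one orbit. *)

(* Defs.v *)
From mathcomp Require Import all_boot all_algebra finmap.
From mathcomp Require Import boolp classical_sets functions cardinality.

Set Implicit Arguments.
Unset Strict Implicit.
Unset Printing Implicit Defensive.

Import GRing.Theory.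
Local Open Scope classical_set_scope.
Local Open Scope ring_scope.

(* [is_trig_mx] means lower triangular, hence the transpose. *)
Definition upper_group (F : fieldType) (n : nat) : set 'M[F]_n :=
  [set h | h \in unitmx /\ is_trig_mx h^T].

Definition B_congruent (F : fieldType) (n : nat) (X Y : 'M[F]_n) : Prop :=
  exists2 h, upper_group h & h^T *m X *m h = Y.

Definition B_orbit (F : fieldType) (n : nat) (X : 'M[F]_n) : set 'M[F]_n :=
  [set Y | B_congruent X Y].

Definition symmetric_orbits (F : fieldType) (n : nat) : set (set 'M[F]_n) :=
  [set B_orbit X | X in [set X : 'M[F]_n | X \is symmetricmx]].

Arguments symmetric_orbits : clear implicits.

(* [fset_set A] is a junk value (empty) when [A] is infinite, so this is the
   number of orbits only together with [finite_set (symmetric_orbits F n)]. *)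
Definition num_symmetric_orbits (F : fieldType) (n : nat) : nat :=
  #|` fset_set (symmetric_orbits F n)|.

Arguments num_symmetric_orbits : clear implicits.

(* Main.v *)
(* The first row sorts the orbits.  If the corner entry is nonzero, scaling
   it to 1 and clearing the row leaves 1 (+) Z; if the whole row is zero the
   matrix is 0 (+) Z.  Otherwise let j be the first nonzero position of the row:
   the row becomes e_j, and then row and column j can be cleared as well, so
   that {1, j} carries a hyperbolic plane orthogonal to some Z of size n - 2.
   Triangularity of h makes the case, j and the orbit of Z invariants. *)
Require Import Defs.
From mathcomp Require Import all_boot all_algebra finmap.
From mathcomp Require Import boolp classical_sets functions cardinality.

Set Implicit Arguments.
Unset Strict Implicit.
Unset Printing Implicit Defensive.

Import GRing.Theory.
Local Open Scope ring_scope.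

Section Orbits.
Variable F : fieldType.

(** * The triangular group and congruence as an equivalence relation *)

Lemma symmetricE n (X : 'M[F]_n) : (X \is symmetricmx) = (X == X^T).
Proof. by rewrite is_hermitianmxE expr0 scale1r map_mx_id. Qed.

Lemma upperP n (h : 'M[F]_n) :
  upper_group h <->
  (forall i k : 'I_n, (k < i)%N -> h i k = 0) /\ (forall i, h i i != 0).
Proof.
have det_diag : is_trig_mx h^T -> (h \in unitmx) = [forall i, h i i != 0].
  move=> /det_trig; rewrite det_tr unitmxE unitfE => ->.
  by apply/prodf_neq0/forallP => hP i => [|_]; have := hP i; rewrite mxE => ->.
split=> [[hU hT]|[hT hD]].
  split=> [i k ki|]; last by move: hU; rewrite det_diag// => /forallP.
  by have /is_trig_mxP/(_ _ _ ki) := hT; rewrite mxE.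
have hT' : is_trig_mx h^T by apply/is_trig_mxP => i k ik; rewrite mxE hT.
by split; rewrite // det_diag//; apply/forallP.
Qed.

Lemma upper1 n : upper_group (1%:M : 'M[F]_n).
Proof.
apply/upperP; split=> [i k ki|i]; rewrite mxE ?eqxx ?oner_eq0//.
by rewrite -val_eqE gtn_eqF.
Qed.

Lemma upperM n (g h : 'M[F]_n) :
  upper_group g -> upper_group h -> upper_group (g *m h).
Proof.
move=> [gU gT] [hU hT]; split; first by rewrite unitmx_mul gU.
apply/is_trig_mxP => i k ik; rewrite !mxE big1// => l _.
have [li|il] := ltnP i l.
  by have /is_trig_mxP/(_ _ _ li) := hT; rewrite mxE => ->; rewrite mulr0.
have /is_trig_mxP/(_ _ _ (leq_ltn_trans il ik)) := gT.
by rewrite mxE => ->; rewrite mul0r.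
Qed.

Lemma upper_block n (a : F) (u : 'rV_n) (K : 'M_n) :
  upper_group (block_mx a%:M u 0 K) <-> a != 0 /\ upper_group K.
Proof.
rewrite /upper_group /= tr_block_mx trmx0 is_trig_block_mx// eqxx /=.
rewrite !unitmxE det_ublock !unitfE mulf_eq0 negb_or det_scalar expr1.
rewrite tr_scalar_mx scalar_mx_is_trig /=.
by split=> [[/andP[-> ->] ->]|[-> [-> ->]]].
Qed.

Lemma upper_blockP n (h : 'M[F]_(1 + n)) : upper_group h ->
  exists a u K, [/\ h = block_mx a%:M u 0 K, a != 0 & upper_group K].
Proof.
move=> hU; exists (ulsubmx h 0 0), (ursubmx h), (drsubmx h).
have hE : h = block_mx (ulsubmx h 0 0)%:M (ursubmx h) 0 (drsubmx h).
  rewrite -mx11_scalar -[LHS]submxK; congr block_mx.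
  have /upperP[hT _] := hU.
  by apply/matrixP => i k; rewrite !mxE; apply: hT; rewrite !ord1.
by move: hU; rewrite {1}hE => /upper_block[].
Qed.

(** Block inversion preserves the shape with blocks [a], [u], 0, [K], so induction on the size
    applies. Symmetry of congruence rests on this. *)
Lemma upper_inv n (h : 'M[F]_n) : upper_group h -> upper_group (invmx h).
Proof.
elim: n h => [|n IHn] h hU.
  by have -> : invmx h = 1%:M; [apply/matrixP => -[]|exact: upper1].
have [a [u [K [hE a0 KU]]]] := upper_blockP hU.
pose g : 'M[F]_(1 + n) := block_mx a^-1%:M (- a^-1 *: u *m invmx K) 0 (invmx K).
have hg : h *m g = 1%:M.
  rewrite hE [LHS](@mulmx_block F 1 n 1 n 1 n) !mulmx0 !mul0mx !addr0 add0r mulmxV ?KU.1//.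
  rewrite -scalar_mxM mulfV// mul_scalar_mx -scalemxAl scalerA mulrN mulfV//.
  by rewrite scaleN1r addNr -scalar_mx_block.
suff -> : invmx h = g by apply/upper_block; rewrite invr_eq0; split=> //; exact: IHn.
by rewrite -[LHS]mulmx1 -hg mulKmx// hU.1.
Qed.

Lemma B_congruent_refl n (X : 'M[F]_n) : B_congruent X X.
Proof. by exists 1%:M; [exact: upper1|rewrite trmx1 mul1mx mulmx1]. Qed.

Lemma B_congruent_sym n (X Y : 'M[F]_n) : B_congruent X Y -> B_congruent Y X.
Proof.
move=> [h hU <-]; exists (invmx h); first exact: upper_inv.
by rewrite trmx_inv -!mulmxA mulmxV ?hU.1// mulmx1 mulKmx// unitmx_tr hU.1.
Qed.

Lemma B_congruent_trans n (Y X Z : 'M[F]_n) :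
  B_congruent X Y -> B_congruent Y Z -> B_congruent X Z.
Proof.
move=> [h hU <-] [g gU <-]; exists (h *m g); first exact: upperM.
by rewrite trmx_mul !mulmxA.
Qed.

Lemma B_orbit_eq n (X Y : 'M[F]_n) : B_orbit X = B_orbit Y <-> B_congruent X Y.
Proof.
split=> [XY|XY].
  by have : B_orbit Y Y := B_congruent_refl Y; rewrite -XY.
apply/seteqP; split=> Z; last exact: B_congruent_trans.
exact: B_congruent_trans (B_congruent_sym XY).
Qed.

(** * Finite systems of orbit representatives *)

Definition transversal n (I : finType) (f : I -> 'M[F]_n) : Prop :=
  [/\ forall i, f i \is symmetricmx,
      forall X, X \is symmetricmx -> exists i, B_congruent (f i) X &
      forall i j, B_congruent (f i) (f j) -> i = j].

(** Listing the orbits of the representatives exhibits a finite set, which makes [fset_set]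
    meaningful, and turns orbit counting into arithmetic on finite types. *)
Lemma transversal_card n (I : finType) (f : I -> 'M[F]_n) : transversal f ->
  finite_set (symmetric_orbits F n) /\ num_symmetric_orbits F n = #|I|.
Proof.
move=> [fS fE fI].
pose s := [seq B_orbit (f i) | i <- enum I].
have sE : symmetric_orbits F n = [set` [fset x in s]%fset]%classic.
  apply/seteqP; split=> [_ [X XS <-]|O] /=; rewrite inE /=.
    have [i /B_orbit_eq <-] := fE X XS.
    by apply/mapP; exists i; rewrite ?mem_enum.
  by move=> /mapP[i _ ->]; exists (f i) => //=; exact: fS.
split; first by rewrite sE; exact: finite_fset.
rewrite /num_symmetric_orbits sE set_fsetK card_fseq undup_id; first by rewrite size_map -cardE.
by rewrite map_inj_uniq ?enum_uniq// => i j /B_orbit_eq /fI.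
Qed.

(** * Deleting and inserting the index [j] *)

Section Hyperbolic.
Variables (n : nat) (j : 'I_n.+1).
Local Notation P := (row' j 1%:M : 'M[F]_(n, n.+1)).

Lemma row'1_lift i k : P i (lift j k) = (i == k)%:R.
Proof. by rewrite !mxE (inj_eq lift_inj). Qed.

Lemma row'1_skip i : P i j = 0.
Proof. by rewrite !mxE eq_sym (negPf (neq_lift _ _)). Qed.

Lemma mul_row'1 m (A : 'M[F]_(n.+1, m)) : P *m A = row' j A.
Proof. by rewrite /row' -rowsubE. Qed.

Lemma mul_row'1_tr : P *m P^T = 1%:M.
Proof. by apply/matrixP => i k; rewrite mul_row'1 !mxE (inj_eq lift_inj) eq_sym. Qed.

Lemma row'1_mul_delta m (k : 'I_m) : P *m delta_mx j k = 0.
Proof.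
by apply/matrixP => i l; rewrite mul_row'1 !mxE eq_sym (negPf (neq_lift _ _)).
Qed.

Lemma delta_mul_row'1 m (k : 'I_m) : delta_mx k j *m P^T = 0.
Proof. by apply: trmx_inj; rewrite trmx_mul trmxK trmx_delta row'1_mul_delta trmx0. Qed.

Lemma mulmx_row'1_lift m (A : 'M[F]_(m, n)) i k : (A *m P) i (lift j k) = A i k.
Proof.
rewrite mxE (bigD1 k)//= row'1_lift eqxx mulr1 big1 ?addr0// => l lk.
by rewrite row'1_lift (negPf lk) mulr0.
Qed.

Lemma mulmx_row'1_skip m (A : 'M[F]_(m, n)) i : (A *m P) i j = 0.
Proof. by rewrite mxE big1// => l _; rewrite row'1_skip mulr0. Qed.

(** Serves to recover a matrix from its compression by [P] when row and column [j] vanish. *)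
Lemma tr_row'1_mul : P^T *m P = 1%:M - delta_mx j j.
Proof.
have jl k : (j == lift j k) = false by apply: negbTE; exact: neq_lift.
have lj k : (lift j k == j) = false by rewrite eq_sym.
apply/matrixP => i k; case: (unliftP j k) => [k'|] ->.
  rewrite mulmx_row'1_lift mxE; case: (unliftP j i) => [i'|] ->.
    by rewrite row'1_lift !mxE (inj_eq lift_inj) lj subr0 eq_sym.
  by rewrite row'1_skip !mxE jl lj andbF subr0.
rewrite mulmx_row'1_skip !mxE; case: (unliftP j i) => [i'|] ->.
  by rewrite lj subr0.
by rewrite !eqxx subrr.
Qed.

(** [P^T *m X *m P] is [X] with a zero row and column inserted at [j]; that free index pairs with
    the first one to form the hyperbolic plane. *)
Definition hyperbolic_mx (X : 'M[F]_n) : 'M[F]_(1 + n.+1) :=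
  block_mx 0 'e_j ('e_j)^T (P^T *m X *m P).

End Hyperbolic.

(** * Congruence in block form *)

Definition diag_ext n (x : F) (X : 'M[F]_n) : 'M[F]_(1 + n) :=
  block_mx x%:M 0 0 X.

(** Read forwards, this verifies explicit reductions; read backwards, through [B_congruent_block],
    it yields the invariants. *)
Lemma congr_block n (a x : F) (u w : 'rV[F]_n) (K X : 'M[F]_n) :
  (block_mx a%:M u 0 K)^T *m block_mx x%:M w w^T X *m block_mx a%:M u 0 K =
  block_mx (a * x * a)%:M (a *: (x *: u + w *m K)) (a *: (x *: u + w *m K))^T
    (x *: (u^T *m u) + u^T *m w *m K + (u^T *m w *m K)^T + K^T *m X *m K).
Proof.
rewrite tr_block_mx !tr_scalar_mx trmx0 !mulmx_block.
rewrite !mul0mx !mulmx0 !addr0 -!scalar_mxM !mul_scalar_mx !mul_mx_scalar.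
rewrite !mulmxDl -!scalemxAl.
have -> : (a *: (x *: u + w *m K))^T = (a * x) *: u^T + a *: (K^T *m w^T).
  by rewrite linearZ /= linearD /= linearZ /= trmx_mul scalerDr scalerA.
by rewrite !trmx_mul trmxK !mulmxA !scalerDr !scalerA !addrA [X in block_mx _ _ _ (X + _)]addrAC.
Qed.

Lemma B_congruent_block n (x : F) (w : 'rV[F]_n) (X : 'M_n) (Y : 'M_(1 + n)) :
  B_congruent (block_mx x%:M w w^T X) Y ->
  exists (a : F) (u : 'rV[F]_n) (K : 'M[F]_n), [/\ a != 0, upper_group K &
    Y = block_mx (a * x * a)%:M (a *: (x *: u + w *m K))
      (a *: (x *: u + w *m K))^T
      (x *: (u^T *m u) + u^T *m w *m K + (u^T *m w *m K)^T + K^T *m X *m K)].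
Proof.
move=> [h /upper_blockP[a [u [K [-> a0 KU]]]] <-].
by exists a, u, K; split=> //; rewrite -congr_block.
Qed.

Lemma diag_extE n x (X : 'M[F]_n) : diag_ext x X = block_mx x%:M 0 0^T X.
Proof. by rewrite trmx0. Qed.

Lemma hyperbolic_mxE n (j : 'I_n.+1) (X : 'M[F]_n) :
  hyperbolic_mx j X =
  block_mx 0%:M 'e_j ('e_j)^T ((row' j 1%:M)^T *m X *m row' j 1%:M).
Proof. by rewrite [0%:M]raddf0. Qed.

Lemma diag_ext_sym n x (X : 'M[F]_n) :
  X \is symmetricmx -> diag_ext x X \is symmetricmx.
Proof.
by rewrite !symmetricE => /eqP XS; rewrite tr_block_mx tr_scalar_mx !trmx0 -XS.
Qed.

Lemma hyperbolic_mx_sym n (j : 'I_n.+1) (X : 'M[F]_n) :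
  X \is symmetricmx -> hyperbolic_mx j X \is symmetricmx.
Proof.
rewrite !symmetricE => /eqP XS.
by rewrite tr_block_mx trmx0 trmxK !trmx_mul trmxK -XS mulmxA.
Qed.

(** * Invariants separating the normal forms *)

Lemma diag_ext_inj n x y (X Y : 'M[F]_n) :
  B_congruent (diag_ext x X) (diag_ext y Y) ->
  (x == 0) = (y == 0) /\ B_congruent X Y.
Proof.
rewrite diag_extE => /B_congruent_block[a [u [K [a0 KU]]]].
move=> /eq_block_mx[/(congr1 (fun A : 'M_1 => A 0 0))]; rewrite !mxE !mulr1n.
move=> -> urE _ ->; split; first by rewrite !mulf_eq0 (negPf a0) orbF.
exists K => //; rewrite mulmx0 mul0mx trmx0 !addr0.
(* The target has zero first row off the corner, so [a *: (x *: u)] is zero with [a] nonzero: [x] or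
   [u] vanishes. *)
suff -> : x *: (u^T *m u) = 0 by rewrite add0r.
move/eqP: urE; rewrite mul0mx addr0 eq_sym !scaler_eq0 (negPf a0) /=.
by case/orP=> /eqP ->; rewrite ?scale0r// mulmx0 scaler0.
Qed.

(** A zero corner in the target forces [x = 0]; the first row then stays zero and cannot contain
    ['e_j]. *)
Lemma diag_ext_hyperbolic n x (X : 'M[F]_n.+1) j (Y : 'M[F]_n) :
  ~ B_congruent (diag_ext x X) (hyperbolic_mx j Y).
Proof.
rewrite diag_extE => /B_congruent_block[a [u [K [a0 KU]]]].
move=> /eq_block_mx[/(congr1 (fun A : 'M_1 => A 0 0)) + urE _ _].
rewrite !mxE mulr1n => /esym/eqP; rewrite !mulf_eq0 (negPf a0) orbF => /eqP x0.
move/(congr1 (fun A : 'rV_n.+1 => A 0 j))/eqP: urE.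
by rewrite x0 scale0r mul0mx addr0 scaler0 !mxE !eqxx oner_eq0.
Qed.

(** The first row becomes [a] times row [i] of [K], whose leading entry sits at [i]. Deleting index
    [i] from the lower block then relates [X] and [Y]. *)
Lemma hyperbolic_mx_inj n i j (X Y : 'M[F]_n) :
  B_congruent (hyperbolic_mx i X) (hyperbolic_mx j Y) ->
  i = j /\ B_congruent X Y.
Proof.
rewrite hyperbolic_mxE => /B_congruent_block[a [u [K [a0 KU]]]].
have /upperP[KT KD] := KU.
move=> /eq_block_mx[_ + _]; rewrite !scale0r !add0r -rowE => rowK drE.
have ij : i = j.
  apply/eqP; move/(congr1 (fun A : 'rV_n.+1 => A 0 i))/eqP: rowK.
  rewrite !mxE eqxx /=; case: (i == j) => //.
  by rewrite eq_sym mulf_eq0 (negPf a0) (negPf (KD i)).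
split=> //; subst j.
pose P : 'M[F]_(n, n.+1) := row' i 1%:M.
(* This is [K] without row and column [i], still upper triangular because [lift i] is strictly
   increasing. *)
exists (P *m K *m P^T).
  have PKP k l : (P *m K *m P^T) k l = K (lift i k) (lift i l).
    by rewrite -mulmxA -[K *m _]trmxK trmx_mul trmxK !mul_row'1 !mxE.
  by apply/upperP; split=> [k l lk|k]; rewrite PKP ?KD// KT// ltnNge leq_bump2 -ltnNge.
(* Hence the cross terms in [u] live only in column [i] and, transposed, in row [i]; compression by
   [P] kills them. *)
have eK : 'e_i *m K = a^-1 *: 'e_i :> 'rV_n.+1.
  by apply: (scalerI a0); rewrite -rowE -rowK scalerA mulfV// scale1r.
move/(congr1 (fun A => P *m A *m P^T)): drE.
rewrite -/P !mulmxA mul_row'1_tr mul1mx -[_ *m P *m _]mulmxA mul_row'1_tr mulmx1.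
move=> ->; rewrite -[u^T *m _ *m K]mulmxA eK -scalemxAr linearZ /=.
rewrite [(u^T *m _)^T]trmx_mul trmxK trmx_delta 2!(mulmxDr P) 2!mulmxDl.
rewrite -!scalemxAr -!scalemxAl !mulmxA row'1_mul_delta.
rewrite -[_ *m 'e_i *m _]mulmxA delta_mul_row'1 !(mulmx0, mul0mx) scaler0 !add0r.
by rewrite !trmx_mul trmxK !mulmxA.
Qed.

(** * Reduction of symmetric matrices to normal form *)

Lemma symmetric_blockP n (X : 'M[F]_(1 + n)) : X \is symmetricmx ->
  exists (a : F) (v : 'rV[F]_n) (Y : 'M[F]_n),
    X = block_mx a%:M v v^T Y /\ Y \is symmetricmx.
Proof.
rewrite symmetricE => /eqP XS; exists (ulsubmx X 0 0), (ursubmx X), (drsubmx X).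
split; last by rewrite symmetricE trmx_drsub -XS.
by rewrite -mx11_scalar trmx_ursub -XS submxK.
Qed.

Lemma trmx_symmetric n (X : 'M[F]_n) : X \is symmetricmx -> X^T = X.
Proof. by rewrite symmetricE => /eqP <-. Qed.

(** [Y] is the Schur complement of the corner. Quantifying over [Z] lets an orbit representative
    replace [Y] within the same congruence. *)
Lemma diag_ext_reduce n (b : F) (v : 'rV[F]_n) (X : 'M[F]_n) :
  b != 0 -> X \is symmetricmx ->
  exists2 Y, Y \is symmetricmx & forall Z, B_congruent Z Y ->
    B_congruent (diag_ext 1 Z) (block_mx (b ^+ 2)%:M v v^T X).
Proof.
move=> b0 XS; exists (X - (b ^+ 2)^-1 *: (v^T *m v)).
  by rewrite symmetricE linearB /= [(_ *: _)^T]linearZ /= trmx_mul trmxK (trmx_symmetric XS).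
move=> Z [K KU ZE]; exists (block_mx b%:M (b^-1 *: v) 0 K).
  exact/upper_block.
rewrite diag_extE congr_block !mulmx0 !mul0mx trmx0 !addr0 ZE !scale1r mulr1.
rewrite scalerA mulfV// scale1r [(_ *: v)^T]linearZ /= -scalemxAl -scalemxAr scalerA.
by rewrite -invfM -expr2 addrC subrK.
Qed.

Lemma diag_ext0_congruent n (Z X : 'M[F]_n) : B_congruent Z X ->
  B_congruent (diag_ext 0 Z) (block_mx 0%:M 0 0^T X).
Proof.
move=> [K KU <-]; exists (block_mx 1%:M 0 0 K).
  by apply/upper_block; rewrite oner_eq0.
rewrite diag_extE congr_block.
by rewrite !(mulmx0, mul0mx, trmx0, mulr0, mul0r, scaler0, addr0, add0r).
Qed.

Lemma row_leading n (v : 'rV[F]_n) : v != 0 ->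
  exists j, v 0 j != 0 /\ forall k : 'I_n, (k < j)%N -> v 0 k = 0.
Proof.
case/rV0Pn => i0 vi0.
case: (@arg_minnP _ i0 (fun i => v 0 i != 0) (fun i => i) vi0) => j vj jP.
exists j; split=> // k kj; apply/eqP; apply: contraTT kj => /jP.
by rewrite -leqNgt.
Qed.

Lemma hyperbolic_mx_reduce n (v : 'rV[F]_n.+1) (X : 'M[F]_n.+1) :
  2%:R != 0 :> F -> v != 0 -> X \is symmetricmx ->
  exists j, exists2 Y, Y \is symmetricmx & forall Z, B_congruent Z Y ->
    B_congruent (hyperbolic_mx j Z) (block_mx 0%:M v v^T X).
Proof.
move=> two0 /row_leading[j [vj vlt]] XS; exists j.
pose P : 'M[F]_(n, n.+1) := row' j 1%:M.
(* Adding multiples of the first row and column to the others subtracts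
   [u^T v + v^T u] from [X]; [u] is chosen so that row [j] vanishes, and its
   own [j]-th entry [uj] is where dividing by 2 is needed. *)
pose uj := X j j / (2%:R * v 0 j).
pose u := (v 0 j)^-1 *: (row j X - uj *: v).
pose W := X - u^T *m v - v^T *m u.
have uvj k : u 0 j * v 0 k + v 0 j * u 0 k = X j k.
  have uE l : u 0 l = (v 0 j)^-1 * (X j l - uj * v 0 l) by rewrite !mxE.
  have -> : u 0 j = uj.
    have -> : uj = (v 0 j)^-1 * (uj * v 0 j) by rewrite mulrC mulfK.
    rewrite uE; congr (_ * _); apply/eqP; rewrite subr_eq -mulr2n -mulr_natl.
    by rewrite mulrCA divfK ?mulf_neq0.
  by rewrite uE mulrA mulfV// mul1r addrC subrK.
have {}WS : W^T = W.
  rewrite /W !linearB /= !trmx_mul !trmxK (trmx_symmetric XS).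
  by rewrite addrAC.
clearbody u.
have Wj m (k : 'I_m) : delta_mx k j *m W = 0.
  suff rW : row j W = 0 by rewrite -(mul_delta_mx (0 : 'I_1)) -mulmxA -rowE rW mulmx0.
  apply/rowP => k'; rewrite /W !mxE !big_ord1 !mxE -addrA -opprD.
  by rewrite uvj subrr.
(* Row [j] of [W] vanishes, hence by symmetry column [j] too, so deleting and reinserting index [j]
   loses nothing. *)
have WE : P^T *m (P *m W *m P^T) *m P = W.
  rewrite !mulmxA tr_row'1_mul mulmxBl mul1mx Wj subr0 -mulmxA tr_row'1_mul.
  rewrite mulmxBr mulmx1; apply: trmx_inj.
  by rewrite linearB /= trmx_mul trmx_delta WS Wj subr0.
exists (P *m W *m P^T).
  by rewrite symmetricE !trmx_mul trmxK WS mulmxA.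
move=> Z [h /upperP[hT hD] ZE].
(* Row [j] of [K] is [v]; the other rows come from [h], with 0 in column [j]. This is triangular
   with nonzero diagonal because the leading entry of [v] is at [j]. *)
pose K := P^T *m h *m P + delta_mx j 0 *m v.
have eK : 'e_j *m K = v.
  rewrite mulmxDr !mulmxA delta_mul_row'1 !mul0mx add0r mul_delta_mx.
  by rewrite [delta_mx _ _]mx11_scalar mxE !eqxx mul1mx.
have PK : P *m K = h *m P.
  by rewrite mulmxDr !mulmxA mul_row'1_tr row'1_mul_delta mul0mx addr0 mul1mx.
have Kj k : K j k = v 0 k by rewrite -eK -rowE [RHS]mxE.
have Kl i k : K (lift j i) k = (h *m P) i k by rewrite -PK mul_row'1 [RHS]mxE.
have KU : upper_group K.
  apply/upperP; split=> [i k|i]; case: (unliftP j i) => [i'|] ->.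
  - rewrite Kl; case: (unliftP j k) => [k'|] ->; last by rewrite mulmx_row'1_skip.
    by rewrite mulmx_row'1_lift ltnNge leq_bump2 -ltnNge => /hT.
  - by rewrite Kj => /vlt.
  - by rewrite Kl mulmx_row'1_lift.
  - by rewrite Kj.
exists (block_mx 1%:M u 0 K); first by apply/upper_block; rewrite oner_eq0.
rewrite hyperbolic_mxE congr_block -/P.
rewrite !(mulr0, mul0r, scale0r, scale1r, add0r) -[u^T *m _ *m K]mulmxA eK.
(* As [P *m K = h *m P], the compression of [W] is reinserted here; the terms in [u] then add back
   what was subtracted from [X]. *)
have -> : K^T *m (P^T *m Z *m P) *m K = W.
  rewrite -[RHS]WE -ZE !mulmxA -trmx_mul PK -[_ *m P *m K]mulmxA PK.
  by rewrite trmx_mul !mulmxA.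
by rewrite trmx_mul trmxK addrC /W addrA addrAC subrK subrK.
Qed.

(** * Recursive construction of representatives *)

Definition step_family n (I J : finType) (f : I -> 'M[F]_n.+1)
    (g : J -> 'M[F]_n) (k : (bool * I) + ('I_n.+1 * J)) : 'M[F]_n.+2 :=
  match k with
  | inl p => diag_ext p.1%:R (f p.2)
  | inr p => hyperbolic_mx p.1 (g p.2)
  end.

Hypothesis two_neq0 : 2%:R != 0 :> F.
Hypothesis all_squares : forall x : F, exists y : F, x = y ^+ 2.

(** Congruence detects whether the corner is zero, which is enough to tell 0 from 1. *)
Lemma diag_ext_transversal_inj n (I : finType) (f : I -> 'M[F]_n) :
  transversal f -> forall (k l : bool * I),
  B_congruent (diag_ext k.1%:R (f k.2)) (diag_ext l.1%:R (f l.2)) -> k = l.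
Proof.
move=> [_ _ fI] [x i] [y j] /= /diag_ext_inj[xy /fI ->].
by move: xy; case: x; case: y; rewrite ?eqxx ?oner_eq0.
Qed.

(** The hypothesis on squares enters here: a nonzero corner is some [b ^+ 2], hence reducible to 1,
    so the corner leaves only two choices. *)
Lemma diag_ext_transversal_ex n (I : finType) (f : I -> 'M[F]_n) a v X :
  transversal f -> X \is symmetricmx -> (a != 0) || (v == 0) ->
  exists k : bool * I,
    B_congruent (diag_ext k.1%:R (f k.2)) (block_mx a%:M v v^T X).
Proof.
move=> [_ fE _] XS; have [->|a0] := eqVneq a 0 => /=.
  move=> /eqP ->; have [i iX] := fE _ XS.
  by exists (false, i); exact: diag_ext0_congruent.
have [b ab] := all_squares a; move: a0; rewrite ab expf_eq0 /= => b0 _.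
have [Y YS YP] := diag_ext_reduce v b0 XS; have [i iY] := fE _ YS.
by exists (true, i); exact: YP.
Qed.

Lemma transversal0 : transversal (fun _ : unit => 0 : 'M[F]_0).
Proof.
split=> [_|X _|[] []//]; first by rewrite symmetricE trmx0.
by exists tt; rewrite [X]thinmx0; exact: B_congruent_refl.
Qed.

(** In size 1 the row beside the corner is empty, so the hyperbolic case cannot arise. *)
Lemma transversal1 (I : finType) (f : I -> 'M[F]_0) : transversal f ->
  transversal (fun k : bool * I => diag_ext k.1%:R (f k.2) : 'M_1).
Proof.
move=> fT; have [fS _ _] := fT; split; last exact: diag_ext_transversal_inj.
  by move=> k; exact: diag_ext_sym.
move=> X /(@symmetric_blockP 0)[a [v [Y [-> YS]]]].
by apply: diag_ext_transversal_ex; rewrite // [v]thinmx0 eqxx orbT.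
Qed.

Lemma step_transversal n (I J : finType) (f : I -> 'M[F]_n.+1)
    (g : J -> 'M[F]_n) :
  transversal f -> transversal g -> transversal (step_family f g).
Proof.
move=> fT gT; have [fS _ _] := fT; have [gS gE gI] := gT; split.
- by case=> k; [exact: diag_ext_sym|exact: hyperbolic_mx_sym].
- move=> X /(@symmetric_blockP n.+1)[a [v [Y [-> YS]]]].
  have [av|] := boolP ((a != 0) || (v == 0)).
    have [k kX] := diag_ext_transversal_ex fT YS av.
    by exists (inl k).
  rewrite negb_or negbK => /andP[/eqP -> v0].
  have [j [Z ZS ZP]] := hyperbolic_mx_reduce two_neq0 v0 YS.
  by have [i iZ] := gE _ ZS; exists (inr (j, i)); exact: ZP.
- case=> [k|[j i]] [l|[m i']] /=.
  + by move/(diag_ext_transversal_inj fT) ->.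
  + by move/diag_ext_hyperbolic.
  + by move/B_congruent_sym/diag_ext_hyperbolic.
  + by move=> /hyperbolic_mx_inj[-> /gI ->].
Qed.

(** The construction reaches back two sizes, so the induction carries a pair of consecutive
    sizes. *)
Lemma transversal_ex n : exists (I : finType) (f : I -> 'M[F]_n), transversal f.
Proof.
suff [] : (exists (I : finType) (f : I -> 'M[F]_n), transversal f) /\
          (exists (I : finType) (f : I -> 'M[F]_n.+1), transversal f) by [].
elim: n => [|n [[J [g gT]] [I [f fT]]]]; split.
- by exists unit, (fun=> 0); exact: transversal0.
- by do 2 eexists; exact: transversal1 transversal0.
- by exists I, f.
- by do 2 eexists; exact: step_transversal fT gT.
Qed.

End Orbits.

Theorem theorem6p2 (F : fieldType)
    (char_neq2 : 2%N \notin [pchar F])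
    (all_squares : forall x : F, exists y : F, x = y ^+ 2) :
  let D := num_symmetric_orbits F in
  (forall n : nat, finite_set (symmetric_orbits F n)) /\
  D 0%N = 1%N /\
  D 1%N = 2%N /\
  (forall n : nat, (2 <= n)%N ->
     D n = (2 * D (n - 1) + (n - 1) * D (n - 2))%N).
Proof.
have two0 : 2%:R != 0 :> F by move: char_neq2; rewrite inE.
have ex := transversal_ex two0 all_squares; rewrite /=; split=> [n|].
  by have [I [f /transversal_card[]]] := ex n.
have T0 := transversal0 F.
have [_ ->] := transversal_card T0.
have [_ ->] := transversal_card (transversal1 all_squares T0).
rewrite card_prod card_bool card_unit; split=> //; split=> // -[|[|n]]// _.
(* The size is now n + 2, and the factor n + 1 counts the possible positions [j]. *)
rewrite subn1 subn2 /=.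
(* Any transversal computes the count, so the same [f] and [g] can serve on both sides of the
   recursion. *)
have [I [f fT]] := ex n.+1; have [J [g gT]] := ex n.
have [_ ->] := transversal_card (step_transversal two0 all_squares fT gT).
have [_ ->] := transversal_card fT; have [_ ->] := transversal_card gT.
by rewrite card_sum !card_prod card_bool card_ord.
Qed.
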